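(* Let $X$ be a geodesic space, let $D\subset X$ be a domain, let $w\in A_p(D)$ with $1\le p<\infty$, let $C$ and $A\ge1$ be constants (possibly depending on $C_d$), and let $B_1,B_2\subset D$ be balls satisfying (i) $A^{-1}\mathrm{rad}(B_i)\le d(B_i,\partial D)\le A\,\mathrm{rad}(B_i)$, $i=1,2$, (ii) $k_D(B_1,B_2)\le C$. Then $$K^{-1}\int_{B_2}w\,d\mu\le\int_{B_1}w\,d\mu\le K\int_{B_2}w\,d\mu,$$ where the constant $K\ge1$ depends only on $C$, $A$, $C_d$, $p$, and $[w]_p$.
   Context: $(X,d,\mu)$ is a complete metric space with a nontrivial Borel regular measure $\mu$ that is doubling: there is a constant $C_d>1$ with $0<\mu(2B)\le C_d\,\mu(B)<\infty$ for all balls $B\subset X$. A ball $B=B(x,r)=\{y: d(x,y)<r\}$ comes with a given center $x$ and radius $\mathrm{rad}(B)=r$; $cB=B(x,cr)$. For sets, $d(A_1,A_2)=\inf\{d(x,y):x\in A_1,y\in A_2\}$. A complete metric space $(X,d)$ is a geodesic space if any two points $x,y\in X$ can be joined by a continuous rectifiable curve $\gamma$ with length $\ell(\gamma)=d(x,y)$. A domain is a nonempty proper open subset $D$ of $X$ in which every two points can be joined by a rectifiable curve entirely contained in $D$. $L^1_{\mathrm{loc}}(D)$ is the class of functions integrable on every compact subset of $D$. For $1<p<\infty$, $A_p(D)$ is the class of a.e. positive $w\in L^1_{\mathrm{loc}}(D)$ with $$[w]_p=\sup_{B\subset D}\left(\frac{1}{\mu(B)}\int_Bw\,d\mu\right)\left(\frac{1}{\mu(B)}\int_Bw^{-\frac{1}{p-1}}\,d\mu\right)^{p-1}<\infty,$$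 the supremum being over all balls $B\subset D$. $A_1(D)$ is the class of nonnegative $w\in L^1_{\mathrm{loc}}(D)$ for which there is a constant $c>0$ with $\frac{1}{\mu(B)}\int_Bw\,d\mu\le c\operatorname*{ess\,inf}_Bw$ for all balls $B\subset D$; $[w]_1$ is the infimum of such $c$. Weights are assumed positive a.e. The quasihyperbolic distance in $D$ is $k_D(x_1,x_2)=\inf_\gamma\int_\gamma\frac{ds}{d(y,\partial D)}$ for $x_1,x_2\in D$, the infimum being over all rectifiable curves $\gamma\subset D$ with endpoints $x_1$ and $x_2$; for subsets $E_1,E_2\subset D$, $k_D(E_1,E_2)=\inf_{x_1\in E_1,\,x_2\in E_2}k_D(x_1,x_2)$. *)

(* Defs.v *)
From HB Require Import structures.
From mathcomp Require Import all_boot all_order all_algebra.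
From mathcomp Require Import all_classical all_reals all_analysis.
From mathcomp Require Import ess_sup_inf.

Set Implicit Arguments.
Unset Strict Implicit.
Unset Printing Implicit Defensive.

Import Order.TTheory GRing.Theory Num.Theory.
Import numFieldNormedType.Exports.

Local Open Scope classical_set_scope.
Local Open Scope ring_scope.
Local Open Scope ereal_scope.

(* The library's completeness class carries a base point, i.e. it only covers
   nonempty spaces. *)
#[short(type="completeMetricType")]
HB.structure Definition CompleteMetric (R : numDomainType) :=
  {T of Complete T & Metric R T}.

Definition boundary (T : topologicalType) (A : set T) : set T :=
  closure A `\` interior A.

(* inf of the empty set is +oo *)
Definition set_dist (R : realType) (X : metricType R) (A1 A2 : set X) :
    \bar R :=
  ereal_inf [set (mdist x y)%:E | x in A1 & y in A2].

(** Curves *)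

(* Supremum over partitions a = t_0 < ... < t_n = b of the sums of
   d(g t_i, g t_(i+1)); same shape as total_variation in realfun. *)
Definition curve_length (R : realType) (X : metricType R) (g : R -> X)
    (a b : R) : \bar R :=
  ereal_sup [set (\sum_(0 <= i < size s)
                    mdist (g (nth b (a :: s) i)) (g (nth b (a :: s) i.+1)))%:E
            | s in itv_partition a b].

Record rectifiable_curve (R : realType) (X : metricType R) (D : set X)
    (x y : X) (g : R -> X) (a b : R) : Prop := RectifiableCurve {
  curve_le : (a <= b)%R ;
  curve_continuous : {within `[a, b], continuous g} ;
  curve_in : g @` `[a, b] `<=` D ;
  curve_start : g a = x ;
  curve_end : g b = y ;
  curve_rectifiable : curve_length g a b < +oo }.

(* The arc-length parametrization g_s of g, determined on [0, length of g] by
   g_s (length of g on [a, t]) = g t. *)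
Definition arclength_param (R : realType) (X : metricType R) (g : R -> X)
    (a b : R) (u : R) : X :=
  g (xget a [set t | (a <= t <= b)%R /\ curve_length g a t = u%:E]).

Definition line_integral (R : realType) (X : metricType R) (rho : X -> \bar R)
    (g : R -> X) (a b : R) : \bar R :=
  \int[lebesgue_measure]_(u in `[0%R, fine (curve_length g a b)])
    rho (arclength_param g a b u).

Definition geodesic_space (R : realType) (X : metricType R) : Prop :=
  forall x y : X, exists g a b,
    rectifiable_curve setT x y g a b /\ curve_length g a b = (mdist x y)%:E.

Definition domain (R : realType) (X : metricType R) (D : set X) : Prop :=
  [/\ D !=set0, D != setT, open D &
    forall x y, D x -> D y -> exists g a b, rectifiable_curve D x y g a b].

Definition quasihyperbolic (R : realType) (X : metricType R) (D : set X)
    (x1 x2 : X) : \bar R :=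
  ereal_inf [set l | exists g a b, rectifiable_curve D x1 x2 g a b /\
    l = line_integral (fun y => (set_dist [set y] (boundary D))^-1) g a b].

Definition quasihyperbolic_set (R : realType) (X : metricType R)
    (D E1 E2 : set X) : \bar R :=
  ereal_inf [set quasihyperbolic D x1 x2 | x1 in E1 & x2 in E2].

(** Measures *)

(* As usual in analysis on metric spaces, a Borel regular measure is defined on
   all subsets; measurable functions and integrals refer to the sigma-algebra
   of Caratheodory measurable sets. *)
Definition borel_regular (R : realType) (X : topologicalType)
    (mu : {outer_measure set X -> \bar R}) : Prop :=
  (forall E : set X, <<s @open X >> E -> mu.-caratheodory E) /\
  (forall E : set X, exists2 G, <<s @open X >> G & E `<=` G /\ mu E = mu G).

Definition doubling (R : realType) (X : metricType R)
    (mu : {outer_measure set X -> \bar R}) (Cd : R) : Prop :=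
  forall (x : X) (r : R), (0 < r)%R ->
    [/\ 0 < mu (ball x (2 * r)),
        mu (ball x (2 * r)) <= Cd%:E * mu (ball x r) &
        Cd%:E * mu (ball x r) < +oo].

Definition cara_measure (R : realType) (X : pointedType)
    (mu : {outer_measure set X -> \bar R}) :
    {measure set (caratheodory_type mu) -> \bar R} :=
  (mu : set (caratheodory_type mu) -> \bar R).

Definition average (R : realType) (X : pointedType)
    (mu : {outer_measure set X -> \bar R}) (B : set X) (f : X -> R) : \bar R :=
  (mu B)^-1 * \int[cara_measure mu]_(x in B) (f x)%:E.

(* Essential infimum of f on B: off B, f is replaced by +oo. *)
Definition ess_inf_on (R : realType) (X : pointedType)
    (mu : {outer_measure set X -> \bar R}) (B : set X) (f : X -> R) : \bar R :=
  ess_inf (cara_measure mu) (patch (fun=> +oo) B (EFin \o f)).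

(** Muckenhoupt weights; functions on D are represented by functions on X whose
    values off D are irrelevant *)

Definition loc_integrable (R : realType) (X : completeMetricType R)
    (mu : {outer_measure set X -> \bar R}) (D : set X) (w : X -> R) : Prop :=
  forall K : set X, compact K -> K `<=` D ->
    (cara_measure mu).-integrable K (EFin \o w).

Definition weight (R : realType) (X : completeMetricType R)
    (mu : {outer_measure set X -> \bar R}) (D : set X) (w : X -> R) : Prop :=
  loc_integrable mu D w /\
  {ae cara_measure mu, forall x, D x -> (0 < w x)%R}.

(* The value [w]_p for 1 < p *)
Definition Ap_const (R : realType) (X : completeMetricType R)
    (mu : {outer_measure set X -> \bar R}) (D : set X) (p : R) (w : X -> R) :
    \bar R :=
  ereal_sup [set average mu (ball z.1 z.2) w *
      (average mu (ball z.1 z.2) (fun x => w x `^ (- (p - 1)^-1))%R)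
        `^ (p - 1)
    | z in [set z : X * R | (0 < z.2)%R /\ ball z.1 z.2 `<=` D]].

Definition A1_bound (R : realType) (X : completeMetricType R)
    (mu : {outer_measure set X -> \bar R}) (D : set X) (w : X -> R) (c : R) :
    Prop :=
  (0 < c)%R /\ forall (x : X) (r : R), (0 < r)%R -> ball x r `<=` D ->
    average mu (ball x r) w <= c%:E * ess_inf_on mu (ball x r) w.

Definition A1_const (R : realType) (X : completeMetricType R)
    (mu : {outer_measure set X -> \bar R}) (D : set X) (w : X -> R) : \bar R :=
  ereal_inf [set c%:E | c in A1_bound mu D w].

Definition muckenhoupt_const (R : realType) (X : completeMetricType R)
    (mu : {outer_measure set X -> \bar R}) (D : set X) (p : R) (w : X -> R) :
    \bar R :=
  if p == 1%R then A1_const mu D w else Ap_const mu D p w.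

Definition muckenhoupt (R : realType) (X : completeMetricType R)
    (mu : {outer_measure set X -> \bar R}) (D : set X) (p : R) (w : X -> R) :
    Prop :=
  weight mu D w /\
  if p == 1%R then exists c, A1_bound mu D w c else Ap_const mu D p w < +oo.

(* Main.v *)
Require Import Defs.
From mathcomp Require Import all_boot all_order all_algebra.
From mathcomp Require Import all_classical all_reals all_analysis.
From mathcomp Require Import measurable_realfun ess_sup_inf hoelder lra ring.

(** Write [d z] for the distance from [z] to the boundary of [D].

    The integrals of a Muckenhoupt weight over nested balls [E] and [B] of [D] are
    comparable as soon as the radii are ([weight_ball_compare]). For [1 < p] this
    is Hoelder's inequality applied to the factorization of 1 into the powers
    [1 / p] and [- 1 / p] of the weight on [E]; for [p = 1] it holds because the
    essential infimum over [B] is at most the mean over [E]. Doubling turns the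
    ratio of the measures into a constant.

    A geodesic that leaves [D] meets the boundary, so the ball of radius [d z]
    around a point [z] of [D] lies in [D] ([ball_boundary_dist_sub]). Call the ball of radius [d z / 4] around [z] the
    Whitney ball at [z]. Two Whitney balls with centers [z] and [z'] at distance at
    most [d z / 4] lie in the ball of radius [d z] around [z], hence carry
    comparable weights ([whitney_ball_step]). In the same way a ball whose radius
    is comparable to its distance to the boundary is comparable to the Whitney
    ball at each of its points ([whitney_ball_compare]).

    Some curve joins a point of the first ball to a point of the second with
    quasihyperbolic length less than [C + 1]. Walk along it in steps of length
    [d z / 4]. As [d] is 1-Lipschitz, each step but the last uses at least
    [1 / 5] of the quasihyperbolic length, so the number of steps is bounded in terms of [C]
    ([harnack_chain]), and so is the product of the constants.

    Two points need preparation. The line integral is taken along the arc-length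
    parametrization, which is 1-Lipschitz and joins the end points because the
    length of the initial pieces of a continuous rectifiable curve takes every
    intermediate value ([curve_length_surjective], [arclength_paramP]). And the
    weight is measurable on balls of [D] because they are exhausted by closed
    balls, which are compact in a complete space with a doubling measure
    ([compact_closed_ball], [measurable_loc_integrable_ball]). *)

Set Implicit Arguments.
Unset Strict Implicit.
Unset Printing Implicit Defensive.

Import Order.TTheory GRing.Theory Num.Theory.
Import numFieldNormedType.Exports.

Local Open Scope classical_set_scope.
Local Open Scope ring_scope.
Local Open Scope ereal_scope.

(** * Length of curves *)

Section Length.
Context {R : realType} {X : metricType R}.
Implicit Types (g : R -> X) (a b c t u : R) (s : seq R).

(** A recursive form of the sums whose supremum is [curve_length], suited to
    induction on the partition. *)
Fixpoint polygon_length g a s : R :=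
  if s is x :: s' then (mdist (g a) (g x) + polygon_length g x s')%R else 0%R.

Lemma polygon_lengthE g a b s :
  (\sum_(0 <= i < size s)
     mdist (g (nth b (a :: s) i)) (g (nth b (a :: s) i.+1)))%R =
  polygon_length g a s.
Proof.
elim: s a => [|x s IH] a /=; first by rewrite big_nil.
by rewrite big_nat_recl//= -IH.
Qed.

Lemma polygon_length_cat g a s1 s2 :
  polygon_length g a (s1 ++ s2) =
  (polygon_length g a s1 + polygon_length g (last a s1) s2)%R.
Proof. by elim: s1 a => [|x s1 IH] a /=; rewrite ?add0r// IH addrA. Qed.

Lemma polygon_length_le g a b s : itv_partition a b s ->
  (polygon_length g a s)%:E <= curve_length g a b.
Proof.
by move=> abs; apply: ereal_sup_ubound; exists s; rewrite ?polygon_lengthE.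
Qed.

Lemma curve_length_leP g a b (l : \bar R) :
  (forall s, itv_partition a b s -> (polygon_length g a s)%:E <= l) ->
  curve_length g a b <= l.
Proof.
by move=> H; apply: ge_ereal_sup => _ [s abs <-]; rewrite polygon_lengthE; exact: H.
Qed.

Lemma curve_length_gtP g a b (l : \bar R) : l < curve_length g a b ->
  exists2 s, itv_partition a b s & l < (polygon_length g a s)%:E.
Proof.
move=> /ereal_sup_gt[_ [s abs <-]]; rewrite polygon_lengthE => ?.
by exists s.
Qed.

Lemma mdist_le_curve_length g a b : (a <= b)%R ->
  (mdist (g a) (g b))%:E <= curve_length g a b.
Proof.
rewrite le_eqVlt => /predU1P[->|ab].
  rewrite mdistxx; apply: (@polygon_length_le g b b [::]).
  by rewrite /itv_partition/=.
have := polygon_length_le g (itv_partition1 ab).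
by rewrite /= addr0.
Qed.

Lemma curve_length_ge0 g a b : (a <= b)%R -> 0 <= curve_length g a b.
Proof.
by move=> ab; apply: le_trans (mdist_le_curve_length g ab); rewrite lee_fin mdist_ge0.
Qed.

(** Partitions of the two pieces concatenate to one of the whole interval; the
    infinite case is apart because suprema are bounded here by moving one
    length to the other side. *)
Lemma curve_length_superadd g a b c : (a <= b)%R -> (b <= c)%R ->
  curve_length g a b + curve_length g b c <= curve_length g a c.
Proof.
move=> ab bc.
have key s1 : itv_partition a b s1 ->
    (polygon_length g a s1)%:E + curve_length g b c <= curve_length g a c.
  move=> abs1; rewrite addeC -leeBrDr//.
  apply: curve_length_leP => s2 bcs2; rewrite leeBrDr// addeC -EFinD.
  have -> : b = last a s1 by case: abs1 => _ /eqP.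
  rewrite -polygon_length_cat; apply: polygon_length_le.
  exact: itv_partition_cat abs1 bcs2.
have [/eqP bcy|bcfin] := boolP (curve_length g b c == +oo).
  have [s abs] : exists s, itv_partition a b s.
    move: ab; rewrite le_eqVlt => /predU1P[->|ab].
      by exists [::]; rewrite /itv_partition /=.
    by exists [:: b]; apply: itv_partition1.
  have := key _ abs; rewrite bcy addey// leye_eq => /eqP ->.
  exact: leey.
have fin : curve_length g b c \is a fin_num.
  by rewrite ge0_fin_numE ?ltey// curve_length_ge0.
rewrite -leeBrDr//; apply: curve_length_leP => s1 abs1.
by rewrite leeBrDr//; exact: key.
Qed.

(** Inserting the point [b] in a partition of [[a, c]] can only increase the
    polygonal length, by the triangle inequality. *)
Lemma curve_length_subadd g a b c : (a <= b)%R -> (b <= c)%R ->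
  curve_length g a c <= curve_length g a b + curve_length g b c.
Proof.
move=> ab bc; apply: curve_length_leP => s; elim: s a ab => [|x s IH] a ab.
  by move=> _; rewrite adde_ge0// curve_length_ge0.
move=> acs; have ax : (a < x)%R by case: acs => /= /andP[].
have xcs := itv_partition_cons acs.
have [xb|bx] := leP x b => /=.
  rewrite EFinD; apply: (le_trans (leeD2l _ (IH _ xb xcs))).
  rewrite addeA leeD2r//.
  apply: le_trans (curve_length_superadd g (ltW ax) xb).
  by rewrite leeD2r// mdist_le_curve_length// ltW.
apply: (@le_trans _ _
  ((mdist (g a) (g b))%:E + (mdist (g b) (g x) + polygon_length g x s)%:E)).
  by rewrite -EFinD lee_fin addrA lerD2r metric_triangle.
apply: leeD; first exact: mdist_le_curve_length.
apply: (@polygon_length_le g b c (x :: s)).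
by case: xcs => xs lx; split => //=; rewrite bx.
Qed.

Lemma curve_length_nondecreasing g a t u : (a <= t)%R -> (t <= u)%R ->
  curve_length g a t <= curve_length g a u.
Proof.
move=> at_ tu; apply: le_trans (curve_length_superadd g at_ tu).
by rewrite leeDl// curve_length_ge0.
Qed.

End Length.

(** * Arc-length parametrization *)

Section Arclength.
Context {R : realType} {X : metricType R}.
Implicit Types (g : R -> X) (a b c t u e : R).

Lemma within_continuous_mdist g a b t e :
  {within `[a, b], continuous g} -> (a <= t <= b)%R -> (0 < e)%R ->
  exists2 d : R, (0 < d)%R & forall t', (a <= t' <= b)%R -> (`|t - t'| < d)%R ->
    (mdist (g t) (g t') < e)%R.
Proof.
move=> /subspace_continuousP/(_ t) cg tab e0.
have /cg/metricType_numDomainType.cvgr_dist_lt/(_ e e0) : [set` `[a, b]%R] t.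
  by rewrite /= in_itv.
rewrite near_withinE => /nbhs_ballP[d /= d0 H].
by exists d => // t' t'ab tt'; apply: H => //=; rewrite in_itv.
Qed.

(** Left lower semicontinuity of the length of the initial piece: a partition
    of [[a, t]] whose polygonal length exceeds [u] still does so after its last
    point [t] has been moved slightly to the left. *)
Lemma curve_length_lower_cont g a b t (u : \bar R) :
  {within `[a, b], continuous g} -> (a <= t <= b)%R -> 0 <= u ->
  u < curve_length g a t ->
  exists2 t', (a <= t' < t)%R & u < curve_length g a t'.
Proof.
move=> cg /andP[at_ tb] u0 /curve_length_gtP[s].
case/lastP: s => [_|s t' [sp /eqP]]; first by rewrite /= ltNge u0.
rewrite last_rcons => tt'; subst t'.
rewrite -cats1 polygon_length_cat/= addr0 => us.
move: sp; rewrite rcons_path => /andP[sp pt].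
have ap : (a <= last a s)%R by apply: (@itv_partition_le _ _ a _ s).
set q := last a s in us pt ap *.
move: u u0 us => [u| |]// _ us.
have e0 : (0 < polygon_length g a s + mdist (g q) (g t) - u)%R.
  by rewrite subr_gt0 -lte_fin.
have [|d d0 H] := within_continuous_mdist cg _ e0 (t := t).
  by rewrite at_.
pose t' := Num.max q (t - d / 2)%R.
have qt' : (q <= t')%R by rewrite le_max lexx.
have t't : (t' < t)%R by rewrite gt_max pt/= ltrBlDr ltrDl divr_gt0.
exists t'; first by rewrite (le_trans ap).
have dt : (mdist (g t) (g t') <
    polygon_length g a s + mdist (g q) (g t) - u)%R.
  apply: H; first by rewrite (le_trans ap)//= (le_trans (ltW t't)).
  rewrite gtr0_norm ?subr_gt0//.
  have : (t - d / 2 <= t')%R by rewrite le_max lexx orbT.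
  lra.
apply: (@lt_le_trans _ _ (polygon_length g a s + mdist (g q) (g t'))%:E).
  have := metric_triangle (g q) (g t') (g t); rewrite lte_fin.
  by rewrite (metric_sym (g t')); lra.
apply: le_trans (curve_length_superadd g ap qt').
by rewrite EFinD leeD ?mdist_le_curve_length ?polygon_length_le.
Qed.

(** The mirror image for final pieces: the first point of the partition is
    moved to the right. *)
Lemma curve_length_lower_cont_right g a b t (u : \bar R) :
  {within `[a, b], continuous g} -> (a <= t <= b)%R -> 0 <= u ->
  u < curve_length g t b ->
  exists2 t', (t < t' <= b)%R & u < curve_length g t' b.
Proof.
move=> cg /andP[at_ tb] u0 /curve_length_gtP[[_|q s tbs]].
  by rewrite /= ltNge u0.
have tq : (t < q)%R by case: tbs => /andP[].
have qbs := itv_partition_cons tbs; have qb := itv_partition_le qbs.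
move: u u0 => [u| |]// _ /= us.
have e0 : (0 < mdist (g t) (g q) + polygon_length g q s - u)%R.
  by rewrite subr_gt0 -lte_fin.
have [|d d0 H] := within_continuous_mdist cg _ e0 (t := t).
  by rewrite at_.
pose t' := Num.min q (t + d / 2)%R.
have t'q : (t' <= q)%R by rewrite ge_min lexx.
have tt' : (t < t')%R by rewrite lt_min tq/= ltrDl divr_gt0.
exists t'; first by rewrite tt' (le_trans t'q).
have dt : (mdist (g t) (g t') <
    mdist (g t) (g q) + polygon_length g q s - u)%R.
  apply: H; first by rewrite (le_trans at_ (ltW tt'))//= (le_trans t'q).
  rewrite ltr0_norm ?subr_lt0//.
  have : (t' <= t + d / 2)%R by rewrite ge_min lexx orbT.
  lra.
apply: (@lt_le_trans _ _ (mdist (g t') (g q) + polygon_length g q s)%:E).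
  by have := metric_triangle (g t) (g t') (g q); rewrite lte_fin; lra.
apply: le_trans (curve_length_superadd g t'q qb).
by rewrite EFinD leeD ?mdist_le_curve_length ?polygon_length_le.
Qed.

(** The witness is the largest [t] at which the length of the initial piece is
    at most [u]. That length cannot exceed [u], by semicontinuity from the left.
    It cannot be smaller either: the rest of the curve would be longer than the
    total length minus [u], and would remain so from some later point on, whose
    initial piece would then have length at most [u]. *)
Lemma curve_length_surjective g a b u : (a <= b)%R ->
  {within `[a, b], continuous g} -> curve_length g a b < +oo ->
  (0 <= u)%R -> u%:E <= curve_length g a b ->
  exists2 t, (a <= t <= b)%R & curve_length g a t = u%:E.
Proof.
move=> ab cg finl u0 ul.
have fin c d : (a <= c)%R -> (c <= d)%R -> (d <= b)%R ->
    curve_length g c d \is a fin_num.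
  move=> ac cd db; rewrite ge0_fin_numE ?curve_length_ge0//.
  apply: le_lt_trans finl.
  apply: le_trans (curve_length_nondecreasing g (le_trans ac cd) db).
  apply: le_trans (curve_length_superadd g ac cd).
  by rewrite leeDr// curve_length_ge0.
pose S := [set t | (a <= t <= b)%R /\ curve_length g a t <= u%:E].
have Sa : S a.
  split; first by rewrite lexx.
  apply: curve_length_leP => s /itv_partitionxx ->.
  by rewrite lee_fin.
have Sb : ubound S b by move=> t [/andP[]].
have hS : has_sup S by split; [exists a|exists b].
pose t := sup S.
have at_ : (a <= t)%R by apply: ub_le_sup => //; exists b.
have tb : (t <= b)%R by apply: ge_sup => //; exists a.
exists t; first by rewrite at_.
apply/eqP; rewrite eq_le; apply/andP; split; rewrite leNgt; apply/negP => H.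
- have [||t' /andP[at' t't] ut'] := curve_length_lower_cont cg _ _ H.
  + by rewrite at_.
  + by rewrite lee_fin.
  have [t2 [/andP[at2 t2b] t2u] t't2] := sup_gt (ex_intro _ _ Sa) t't.
  have := curve_length_nondecreasing g at' (ltW t't2).
  by rewrite leNgt (le_lt_trans t2u).
- have ltL : curve_length g a b - u%:E < curve_length g t b.
    have := curve_length_subadd g at_ tb.
    move: H; rewrite -(fineK (fin _ _ at_ tb (lexx _))).
    rewrite -(fineK (fin _ _ (lexx a) at_ tb)).
    rewrite -(fineK (fin _ _ (lexx a) ab (lexx _))).
    rewrite -!EFinD !lte_fin !lee_fin; lra.
  have [||t' /andP[tt' t'b] H'] := curve_length_lower_cont_right cg _ _ ltL.
  + by rewrite at_.
  + by rewrite sube_ge0.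
  have at' : (a <= t')%R by rewrite (le_trans at_) ?ltW.
  have : (t' <= t)%R.
    apply: ub_le_sup; first by exists b.
    split; first by rewrite at'.
    have := curve_length_superadd g at' t'b.
    move: H'; rewrite -(fineK (fin _ _ at' t'b (lexx _))).
    rewrite -(fineK (fin _ _ (lexx a) at' t'b)).
    rewrite -(fineK (fin _ _ (lexx a) ab (lexx _))).
    rewrite -!EFinD !lte_fin !lee_fin; lra.
  by rewrite leNgt tt'.
Qed.

(** Because every length in [[0, L]] is attained, the choice made in
    [arclength_param] is a genuine one; any two choices for the same length give
    the same point of the curve, and superadditivity of the length makes the
    parametrization 1-Lipschitz. *)
Lemma arclength_paramP (D : set X) x y g a b : rectifiable_curve D x y g a b ->
  let L := fine (curve_length g a b) in
  let h := arclength_param g a b in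
  [/\ (0 <= L)%R, h 0%R = x, h L = y,
      forall u, (0 <= u <= L)%R -> D (h u) &
      forall u v, (0 <= u)%R -> (u <= v)%R -> (v <= L)%R ->
        (mdist (h u) (h v) <= v - u)%R].
Proof.
case=> ab cg gD ga gb finl L h.
have LE : curve_length g a b = L%:E.
  by rewrite fineK// ge0_fin_numE// curve_length_ge0.
have hP u : (0 <= u <= L)%R -> exists t, [/\ (a <= t <= b)%R,
    curve_length g a t = u%:E & h u = g t].
  move=> /andP[u0 uL].
  have [|t tab tu] := curve_length_surjective ab cg finl u0.
    by rewrite LE lee_fin.
  pose S := [set t | (a <= t <= b)%R /\ curve_length g a t = u%:E].
  have [] : S (xget a S) by apply: (@xgetI _ a S t).
  by move=> ? ?; exists (xget a S).
have L0 : (0 <= L)%R by rewrite -lee_fin -LE curve_length_ge0.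
split => //.
- have [|t [/andP[at_ tb] t0 ->]] := hP 0%R; first by rewrite lexx.
  have := mdist_le_curve_length g at_; rewrite t0 lee_fin => d0.
  rewrite -ga; apply/esym/mdist_positivity/eqP.
  by rewrite eq_le d0 mdist_ge0.
- have [|t [/andP[at_ tb] tL ->]] := hP L; first by rewrite L0 lexx.
  have := curve_length_superadd g at_ tb; rewrite tL LE.
  rewrite -leeBrDl// subee// => /(le_trans (mdist_le_curve_length g tb)).
  rewrite lee_fin => d0; rewrite -gb; apply/mdist_positivity/eqP.
  by rewrite eq_le d0 mdist_ge0.
- move=> u /hP[t [tab _ ->]]; by apply: gD; exists t.
- move=> u v u0 uv vL.
  have [|t [/andP[at_ tb] tu ->]] := hP u; first by rewrite u0 (le_trans uv).
  have [|t' [/andP[at' tb'] tv ->]] := hP v; first by rewrite (le_trans u0).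
  have [tt'|/ltW t't] := leP t t'.
    have := curve_length_superadd g at_ tt'; rewrite tu tv.
    rewrite -leeBrDl// => /(le_trans (mdist_le_curve_length g tt')).
    by rewrite -EFinB lee_fin.
  have uv' : u = v.
    apply/eqP; rewrite eq_le uv/= -lee_fin -tu -tv.
    exact: curve_length_nondecreasing.
  have := curve_length_superadd g at' t't; rewrite tu tv uv'.
  rewrite -leeBrDl// => /(le_trans (mdist_le_curve_length g t't)).
  by rewrite -EFinB lee_fin metric_sym.
Qed.

End Arclength.

(** * Distance to the boundary in a geodesic space *)

Section BoundaryDistance.
Context {R : realType} {X : metricType R}.
Implicit Types (D B : set X) (x y z q : X).

Definition boundary_dist D z : R := fine (set_dist [set z] (boundary D)).

Lemma le_set_dist (A1 A2 : set X) (r : \bar R) :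
  r <= set_dist A1 A2 <-> forall x y, A1 x -> A2 y -> r <= (mdist x y)%:E.
Proof.
split => [H x y A1x A2y|H].
  by apply: (le_trans H); apply: ereal_inf_lbound; exists x => //; exists y.
by apply: le_ereal_inf_tmp => _ [x A1x [y A2y <-]]; exact: H.
Qed.

Lemma set_dist_boundaryE D z : boundary D !=set0 ->
  set_dist [set z] (boundary D) = (boundary_dist D z)%:E.
Proof.
move=> [q Dq]; rewrite fineK// ge0_fin_numE.
  apply: (@le_lt_trans _ _ (mdist z q)%:E); last exact: ltry.
  by have /le_set_dist := lexx (set_dist [set z] (boundary D)); exact.
by apply/le_set_dist => x y _ _; rewrite lee_fin mdist_ge0.
Qed.

Lemma le_boundary_dist D z (r : R) : boundary D !=set0 ->
  (r <= boundary_dist D z)%R <-> forall q, boundary D q -> (r <= mdist z q)%R.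
Proof.
move=> D0; rewrite -lee_fin -set_dist_boundaryE//; split.
  by move=> /le_set_dist H q Dq; rewrite -lee_fin H.
by move=> H; apply/le_set_dist => _ q -> Dq; rewrite lee_fin H.
Qed.

Lemma boundary_dist_le D z q : boundary D q -> (boundary_dist D z <= mdist z q)%R.
Proof.
move=> Dq; have /le_boundary_dist := lexx (boundary_dist D z).
by apply => //; exists q.
Qed.

Lemma boundary_dist_lipschitz D x y : boundary D !=set0 ->
  (boundary_dist D x <= mdist x y + boundary_dist D y)%R.
Proof.
move=> D0; rewrite -lerBlDl; apply/le_boundary_dist => // q Dq.
rewrite lerBlDl; apply: le_trans (metric_triangle _ _ _).
exact: boundary_dist_le.
Qed.

Lemma boundary_dist_gt0 D z : boundary D !=set0 -> open D -> D z ->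
  (0 < boundary_dist D z)%R.
Proof.
move=> D0 oD Dz; have /nbhs_ballP[e /= e0 zeD] : nbhs z D by exact: open_nbhs_nbhs.
apply: (@lt_le_trans _ _ e) => //; apply/le_boundary_dist => // q [_ Dq].
rewrite leNgt; apply/negP => zq; apply: Dq.
by rewrite (interior_id _).1//; apply: zeD; rewrite ballEmdist.
Qed.

Lemma geodesic_param x y : geodesic_space X -> exists h : R -> X,
  [/\ h 0%R = x, h (mdist x y) = y &
    forall u v, (0 <= u)%R -> (u <= v)%R -> (v <= mdist x y)%R ->
      (mdist (h u) (h v) <= v - u)%R].
Proof.
move=> /(_ x y)[g [a [b [gr glen]]]].
have := arclength_paramP gr; rewrite glen /= => -[_ h0 hL _ hlip].
by exists (arclength_param g a b).
Qed.

(** The first point of a geodesic from [x] to [y] that lies outside [D] is a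
    boundary point, no farther from [x] than [y] is. *)
Lemma geodesic_crosses_boundary D x y : geodesic_space X -> open D ->
  D x -> ~ D y -> exists2 q, boundary D q & (mdist x q <= mdist x y)%R.
Proof.
move=> geo oD Dx nDy; have [h [h0 hL hlip]] := geodesic_param x y geo.
set L := mdist x y in hL hlip *.
pose S := [set t : R | (0 <= t <= L)%R /\ ~ D (h t)].
have SL : S L by split; [rewrite mdist_ge0 lexx|rewrite hL].
have Slb : lbound S 0%R by move=> t [/andP[]].
have hS : has_inf S by split; [exists L|exists 0%R].
pose t := inf S.
have t0 : (0 <= t)%R by apply: lb_le_inf => //; exists L.
have tL : (t <= L)%R by apply: ge_inf => //; exists 0%R.
have nDt : ~ D (h t).
  move=> Dt; have /nbhs_ballP[e /= e0 teD] : nbhs (h t) D by exact: open_nbhs_nbhs.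
  have [s [[/andP[s0 sL] nDs]] ste] := inf_adherent e0 hS.
  apply: (nDs); apply: teD; rewrite ballEmdist/=.
  have ts : (t <= s)%R.
    apply: ge_inf; [by exists 0%R|split; last exact: nDs].
    by rewrite s0.
  apply: (le_lt_trans (hlip _ _ t0 ts sL)).
  by rewrite ltrBlDl.
have {}t0 : (0 < t)%R.
  by rewrite lt_neqAle t0 andbT; apply/eqP => t00; apply: nDt; rewrite -t00 h0.
exists (h t); last first.
  by rewrite -h0 (le_trans (hlip _ _ (lexx _) (ltW t0) tL))// subr0.
split; last by rewrite (interior_id _).1.
move=> U /nbhs_ballP[e /= e0 teU].
pose s := Num.max 0%R (t - e / 2)%R.
have s0 : (0 <= s)%R by rewrite le_max lexx.
have st : (s < t)%R by rewrite gt_max t0/= ltrBlDr ltrDl divr_gt0.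
exists (h s); split.
  apply: contrapT => nDs.
  have : (t <= s)%R.
    apply: ge_inf; first by exists 0%R.
    by split => //; rewrite s0 (le_trans (ltW st)).
  by rewrite leNgt st.
apply: teU; rewrite ballEmdist/= metric_sym.
apply: (le_lt_trans (hlip _ _ s0 (ltW st) tL)).
have : (t - e / 2 <= s)%R by rewrite le_max lexx orbT.
lra.
Qed.

Lemma ball_boundary_dist_sub D z : geodesic_space X -> open D ->
  boundary D !=set0 -> D z -> ball z (boundary_dist D z) `<=` D.
Proof.
move=> geo oD D0 Dz y; rewrite ballEmdist/= => zy.
apply: contrapT => nDy.
have [q Dq zq] := geodesic_crosses_boundary geo oD Dz nDy.
by have := le_lt_trans (le_trans (boundary_dist_le z Dq) zq) zy; rewrite ltxx.
Qed.

(** On a geodesic from [x] to a boundary point [q] there is a point of the ball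
    at distance almost [r] from [x]; the remaining part of the geodesic has length
    at least [a]. *)
Lemma boundary_dist_center_ge D x (r a : R) : geodesic_space X ->
  boundary D !=set0 -> open D -> (0 < r)%R -> ball x r `<=` D ->
  a%:E <= set_dist (ball x r) (boundary D) -> (r + a <= boundary_dist D x)%R.
Proof.
move=> geo D0 oD r0 BD /le_set_dist H; apply/le_boundary_dist => // q Dq.
have rq : (r <= mdist x q)%R.
  rewrite leNgt; apply/negP => xq; case: Dq => _; apply.
  by rewrite (interior_id _).1//; apply: BD; rewrite ballEmdist.
apply/ler_addgt0Pr => e e0.
have [h [h0 hL hlip]] := geodesic_param x q geo.
pose s := Num.max 0%R (r - e)%R.
have s0 : (0 <= s)%R by rewrite le_max lexx.
have sr : (s < r)%R by rewrite gt_max r0/= ltrBlDr ltrDl.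
have sq := le_trans (ltW sr) rq.
have xs : (mdist x (h s) < r)%R.
  have := hlip _ _ (lexx _) s0 sq; rewrite h0 subr0 => /le_lt_trans; exact.
have : (a <= mdist (h s) q)%R.
  by rewrite -lee_fin H// ballEmdist.
have := hlip _ _ s0 sq (lexx _); rewrite hL.
have : (r - e <= s)%R by rewrite le_max lexx orbT.
lra.
Qed.

Lemma boundary_dist_ge_in_ball D x y (r a : R) : boundary D !=set0 ->
  a%:E <= set_dist (ball x r) (boundary D) ->
  ball x r y -> (a <= boundary_dist D y)%R.
Proof.
move=> D0 /le_set_dist H xy; apply/le_boundary_dist => // q Dq.
by rewrite -lee_fin H.
Qed.

Lemma boundary_dist_le_in_ball D x y (r a : R) : boundary D !=set0 ->
  set_dist (ball x r) (boundary D) <= a%:E ->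
  ball x r y -> (boundary_dist D y <= a + 2 * r)%R.
Proof.
move=> D0 H xy; rewrite -lerBlDr -lee_fin; apply: le_trans H.
apply/le_set_dist => z q xz Dq; rewrite lee_fin.
have := boundary_dist_lipschitz y z D0; have := boundary_dist_le z Dq.
move: xy xz; rewrite !ballEmdist/=.
have := metric_triangle y x z; rewrite (metric_sym y x); lra.
Qed.

(** The distance to an empty set is infinite. *)
Lemma boundary_neq0 D B (a : R) : set_dist B (boundary D) <= a%:E ->
  boundary D !=set0.
Proof.
move=> H; apply/set0P/eqP => D0; move: H.
rewrite leNgt => /negP; apply; apply: (@lt_le_trans _ _ +oo); first exact: ltry.
by apply/le_set_dist => x y; rewrite D0.
Qed.

End BoundaryDistance.

(** * Chains along a curve of bounded quasihyperbolic length *)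

Section Chain.
Context {R : realType} {X : metricType R}.
Variables (D : set X) (h : R -> X) (L : R).
Hypotheses (D0 : boundary D !=set0) (oD : open D).
Hypothesis hD : forall u : R, (0 <= u <= L)%R -> D (h u).
Hypothesis hlip : forall u v : R, (0 <= u)%R -> (u <= v)%R -> (v <= L)%R ->
  (mdist (h u) (h v) <= v - u)%R.

Let density (u : R) : \bar R := (set_dist [set h u] (boundary D))^-1.

Lemma quasihyperbolic_densityE (u : R) : (0 <= u <= L)%R ->
  density u = ((boundary_dist D (h u))^-1)%:E.
Proof.
move=> uL; rewrite /density set_dist_boundaryE// inver.
by rewrite gt_eqF// boundary_dist_gt0//; exact: hD.
Qed.

(** The distance to the boundary is Lipschitz along the curve and positive, so
    its inverse is continuous on the interval. *)
Lemma measurable_quasihyperbolic_density (v : R) : (0 <= v <= L)%R ->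
  measurable_fun (`[v, L] : set R) density.
Proof.
move=> /andP[v0 vL]; pose f u := boundary_dist D (h u).
have in0L u : `[v, L]%classic u -> (0 <= u <= L)%R.
  by rewrite /= in_itv/= => /andP[vu ->]; rewrite (le_trans v0).
apply: (eq_measurable_fun (fun u => ((f u)^-1)%:E)).
  by move=> u; rewrite inE => /in0L u0L; rewrite quasihyperbolic_densityE.
apply/measurable_EFinP; apply: subspace_continuous_measurable_fun => //.
apply/subspace_continuousP => u /in0L u0L; apply: cvgV.
  by rewrite gt_eqF// boundary_dist_gt0//; exact: hD.
apply/cvgrPdist_lt => e e0.
have near_u : \forall u' \near u, (`|u - u'| < e)%R by apply/nbhs_ballP; exists e.
near=> u'.
have u'0L : (0 <= u' <= L)%R.
  by apply: in0L; near: u'; exact: withinT.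
apply: (@le_lt_trans _ _ `|u - u'|%R); last first.
  by near: u'; exact: cvg_within near_u.
have huu' : (mdist (h u) (h u') <= `|u - u'|)%R.
  have [uu'|/ltW u'u] := leP u u'.
    rewrite distrC; apply: le_trans (ler_norm _).
    by apply: hlip => //; [case/andP: u0L|case/andP: u'0L].
  rewrite metric_sym; apply: le_trans (ler_norm _).
  by apply: hlip => //; [case/andP: u'0L|case/andP: u0L].
have := boundary_dist_lipschitz (h u) (h u') D0.
have := boundary_dist_lipschitz (h u') (h u) D0.
by rewrite (metric_sym (h u')) ler_norml -/(f u) -/(f u'); lra.
Unshelve. all: by end_near. Qed.

(** Walk from [h v] to [h L] in steps whose length is a quarter of the current
    distance [d] to the boundary. During a step the distance to the boundary is
    at most [5 / 4 * d], so a step of length [d / 4] costs at least [1 / 5] of the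
    integral, and the budget [n / 5] is exhausted after at most [n] steps; each of
    them changes [F] by a factor at most [K]. *)
Lemma harnack_chain (F : X -> \bar R) (K : R) : (1 <= K)%R ->
  (forall z, D z -> 0 <= F z) ->
  (forall z z', D z -> D z' -> (mdist z z' <= boundary_dist D z / 4)%R ->
    F z <= K%:E * F z' /\ F z' <= K%:E * F z) ->
  forall (n : nat) (v : R), (0 <= v <= L)%R ->
  \int[lebesgue_measure]_(u in `[v, L]) density u < (n%:R / 5)%:E ->
  F (h v) <= (K ^+ n)%:E * F (h L) /\ F (h L) <= (K ^+ n)%:E * F (h v).
Proof.
move=> K1 F0 step; have K0 : (0 <= K)%R by rewrite (le_trans ler01).
have dens0 u : 0 <= density u.
  by rewrite /density inve_ge0; apply/le_set_dist => *; rewrite lee_fin mdist_ge0.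
elim=> [|n IH] v /[dup] vL /andP[v0 vleL].
  by rewrite mul0r ltNge integral_ge0.
have LL : (0 <= L <= L)%R by rewrite lexx (le_trans v0).
set d := boundary_dist D (h v).
have d0 : (0 < d)%R by apply: boundary_dist_gt0 => //; exact: hD.
have Kn : (1 <= K ^+ n)%R by rewrite exprn_ege1.
(* The last step may be shorter: the end point is then within reach. *)
have [near_end _|far] := leP L (v + d / 4)%R.
  have hvL : (mdist (h v) (h L) <= d / 4)%R.
    by apply: (le_trans (hlip v0 vleL (lexx _))); lra.
  have KE z : D z -> K%:E * F z <= (K ^+ n.+1)%:E * F z.
    by move=> /F0 ?; rewrite lee_wpmul2r// lee_fin exprS ler_peMr.
  have [H1 H2] := step _ _ (hD vL) (hD LL) hvL.
  by split; [apply: le_trans H1 (KE _ _)|apply: le_trans H2 (KE _ _)]; exact: hD.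
set v' := (v + d / 4)%R in far *.
have vv' : (v < v')%R by rewrite ltrDl divr_gt0.
have v'L : (0 <= v' <= L)%R by rewrite (le_trans v0 (ltW vv')) ltW.
have mdens := measurable_quasihyperbolic_density vL.
have itvU : `[v, L]%classic = `[v, v'[%classic `|` `[v', L]%classic.
  by rewrite -itv_bndbnd_setU// bnd_simp// ltW.
have cost : (5^-1)%:E <= \int[lebesgue_measure]_(u in `[v, v'[) density u.
  rewrite [leLHS](_ : _ =
    \int[lebesgue_measure]_(u in `[v, v'[) (cst ((5 / 4 * d)^-1)%:E u)).
    apply: ge0_le_integral => //.
    - by move=> u _; rewrite lee_fin invr_ge0 mulr_ge0 ?ltW.
    - by apply: measurable_funS mdens => //; rewrite itvU; exact: subsetUl.
    move=> u; rewrite /= in_itv/= => /andP[vu uv'].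
    have uL : (0 <= u <= L)%R by rewrite (le_trans v0)//= (ltW (lt_trans uv' far)).
    rewrite quasihyperbolic_densityE// lee_fin lef_pV2 ?posrE ?mulr_gt0//; last first.
      by apply: boundary_dist_gt0 => //; exact: hD.
    have := boundary_dist_lipschitz (h u) (h v) D0.
    rewrite metric_sym -/d; move/andP: uL => [_ uL].
    have := hlip v0 vu uL; move: uv'; rewrite /v'; lra.
  rewrite integral_cst//= lebesgue_measure_itv/= lte_fin vv' -EFinB -EFinM.
  congr (_%:E); rewrite /v'; field.
  by rewrite gt_eqF.
rewrite itvU ge0_integral_setU//=; last 2 first.
- by rewrite -itvU.
- apply/disj_setPS => u [] /=; rewrite !in_itv/= => /andP[_ uv'] /andP[v'u _].
  by move: uv'; rewrite ltNge v'u.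
move=> lt_int.
have int' : \int[lebesgue_measure]_(u in `[v', L]) density u < (n%:R / 5)%:E.
  have : (5^-1)%:E + \int[lebesgue_measure]_(u in `[v', L]) density u
      < (n.+1%:R / 5)%:E.
    by apply: le_lt_trans lt_int; rewrite leeD2r.
  rewrite -lteBrDl// => /lt_le_trans; apply.
  by rewrite -EFinB lee_fin -natr1; lra.
have [H1 H2] := IH _ v'L int'.
have hvv' : (mdist (h v) (h v') <= d / 4)%R.
  have /andP[_ /(hlip v0 (ltW vv'))] := v'L; rewrite /v'; lra.
have [G1 G2] := step _ _ (hD vL) (hD v'L) hvv'.
split.
  apply: (le_trans G1); rewrite exprS EFinM -muleA.
  by rewrite lee_wpmul2l.
apply: (le_trans H2); rewrite exprSr EFinM -muleA.
by rewrite lee_wpmul2l// lee_fin exprn_ge0.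
Qed.

End Chain.

(** * Muckenhoupt weights and subsets *)

Section Muckenhoupt.
Context d {T : measurableType d} {R : realType}.
Variable mu : {measure set T -> \bar R}.
Implicit Types (E B : set T) (v : T -> R) (p Q : R).

(** Hoelder's inequality for the factorization of 1 as the product of
    [v `^ p^-1] and [v `^ (- p^-1)] on [E], raised to the power [p]. *)
Lemma hoelder_weight E v p : (1 < p)%R -> measurable E -> measurable_fun E v ->
  (forall x, E x -> 0 < v x)%R ->
  mu E `^ p <= \int[mu]_(x in E) (v x)%:E *
    (\int[mu]_(x in E) (v x `^ (- (p - 1)^-1))%:E) `^ (p - 1).
Proof.
move=> p1 mE mv v0; have p0 : (0 < p)%R by rewrite (lt_trans ltr01).
have p10 : (0 < p - 1)%R by rewrite subr_gt0.
pose q := (p / (p - 1))%R; have q0 : (0 < q)%R by rewrite divr_gt0.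
have pq : (p^-1 + q^-1 = 1)%R.
  by rewrite /q; field; rewrite !gt_eqF.
pose f := (fun x => v x `^ p^-1)%R \_ E.
pose g := (fun x => v x `^ (- p^-1))%R \_ E.
have mpow r : measurable_fun E (fun x => v x `^ r)%R.
  by exact: (measurableT_comp (measurable_powR _) mv).
have mf : measurable_fun setT f.
  by apply/measurable_restrict => //; rewrite setTI.
have mg : measurable_fun setT g.
  by apply/measurable_restrict => //; rewrite setTI.
have := hoelder mu mf mg p0 q0 pq.
rewrite Lnorm1 unlock /Lnorm.
have -> : \int[mu]_x `|(EFin \o (f \* g)%R) x| = mu E.
  transitivity (\int[mu]_x (\1_E x)%:E); last by rewrite integral_indic ?setIT.
  apply: eq_integral => x _; rewrite /= indicE /f /g !patchE.
  have [/[!inE] Ex|_] := boolP (x \in E); last by rewrite mulr0 normr0.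
  rewrite -powRD ?addrN ?powRr0 ?normr1//.
  by apply/implyP => _; rewrite gt_eqF// v0.
have -> : \int[mu]_x `|(EFin \o f) x| `^ p = \int[mu]_(x in E) (v x)%:E.
  rewrite [RHS]integral_mkcond; apply: eq_integral => x _.
  rewrite /= /f !patchE; have [/[!inE] Ex|_] := boolP (x \in E); last first.
    by rewrite normr0 powR0// gt_eqF.
  rewrite ger0_norm ?powR_ge0// -powRrM mulVf ?gt_eqF// powRr1//.
  by rewrite ltW// v0.
have -> : \int[mu]_x `|(EFin \o g) x| `^ q =
    \int[mu]_(x in E) (v x `^ (- (p - 1)^-1))%:E.
  rewrite [RHS]integral_mkcond; apply: eq_integral => x _.
  rewrite /= /g !patchE; have [/[!inE] Ex|_] := boolP (x \in E); last first.
    by rewrite normr0 powR0// gt_eqF.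
  rewrite ger0_norm ?powR_ge0// -powRrM; congr (_ `^ _)%:E.
  by rewrite /q; field; rewrite !gt_eqF.
set a := \int[mu]_(x in E) _; set b := \int[mu]_(x in E) _ => H.
have a0 : 0 <= a by apply: integral_ge0 => x Ex; rewrite lee_fin ltW// v0.
have b0 : 0 <= b by apply: integral_ge0 => x _; rewrite lee_fin powR_ge0.
have := gt0_ler_poweR (ltW p0) _ _ H.
rewrite !in_itv/= !leey !andbT => /(_ (measure_ge0 _ _)).
rewrite mule_ge0 ?poweR_ge0// => /(_ isT) /le_trans; apply.
rewrite poweRM ?poweR_ge0// -!poweRrM mulVf ?gt_eqF// poweRe1//.
by rewrite /q invf_div -mulrA mulVf ?gt_eqF// mulr1.
Qed.

(** Bound the measure of [E] by [hoelder_weight], enlarge the integral of the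
    negative power from [E] to [B], and apply the A_p bound on [B]. Stating the
    bound without division keeps it meaningful for infinite integrals. *)
Lemma Ap_subset_compare B E v p Q : (1 < p)%R -> measurable B -> measurable E ->
  E `<=` B -> measurable_fun B v -> (forall x, B x -> 0 < v x)%R ->
  \int[mu]_(x in B) (v x)%:E *
    (\int[mu]_(x in B) (v x `^ (- (p - 1)^-1))%:E) `^ (p - 1) <=
    Q%:E * mu B `^ p ->
  \int[mu]_(x in B) (v x)%:E * mu E `^ p <=
    (Q%:E * mu B `^ p) * \int[mu]_(x in E) (v x)%:E.
Proof.
move=> p1 mB mE EB mv v0 H.
have mvE : measurable_fun E v by apply: measurable_funS mv.
have int0 S : S `<=` B -> 0 <= \int[mu]_(x in S) (v x)%:E.
  by move=> SB; apply: integral_ge0 => x /SB/v0/ltW; rewrite lee_fin.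
have := hoelder_weight p1 mE mvE (fun x Ex => v0 x (EB x Ex)).
move=> /(lee_wpmul2l (int0 _ (@subset_refl _ B)))/le_trans; apply.
rewrite muleCA muleC; apply: lee_wpmul2r; first exact: int0.
apply: le_trans H; apply: lee_wpmul2l; first exact: int0.
apply: gt0_ler_poweR.
- by rewrite subr_ge0 ltW.
- by rewrite in_itv/= leey andbT integral_ge0// => x _; rewrite lee_fin powR_ge0.
- by rewrite in_itv/= leey andbT integral_ge0// => x _; rewrite lee_fin powR_ge0.
apply: ge0_subset_integral => //.
  apply/measurable_EFinP; exact: (measurableT_comp (measurable_powR _) mv).
by move=> x _; rewrite lee_fin powR_ge0.
Qed.

(** The lower bound [m] of [v] on [B] is at most the mean of [v] over [E]. If [m]
    is negative, then the integral over [B] vanishes. *)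
Lemma A1_subset_compare B E v (c : R) (m : \bar R) :
  measurable B -> measurable E ->
  E `<=` B -> measurable_fun B v -> (forall x, B x -> 0 < v x)%R ->
  (0 <= c)%R ->
  {ae mu, forall x, B x -> m <= (v x)%:E} ->
  \int[mu]_(x in B) (v x)%:E <= c%:E * m * mu B ->
  \int[mu]_(x in B) (v x)%:E * mu E <= (c%:E * mu B) * \int[mu]_(x in E) (v x)%:E.
Proof.
move=> mB mE EB mv v0 c0 mle H.
have int0 S : S `<=` B -> 0 <= \int[mu]_(x in S) (v x)%:E.
  by move=> SB; apply: integral_ge0 => x /SB/v0/ltW; rewrite lee_fin.
have mvE : measurable_fun E v by apply: measurable_funS mv.
have [m0|m0] := leP 0 m; last first.
  have -> : \int[mu]_(x in B) (v x)%:E = 0.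
    apply/eqP; rewrite eq_le int0// andbT (le_trans H)//.
    by rewrite mule_le0_ge0// mule_ge0_le0 ?lee_fin// ltW.
  by rewrite mul0e !mule_ge0 ?lee_fin ?int0.
apply: (le_trans (lee_wpmul2r (measure_ge0 mu E) H)).
rewrite (muleAC c%:E m) -(muleA (c%:E * mu B)) (muleC m).
apply: lee_wpmul2l; first by rewrite mule_ge0 ?lee_fin.
have -> : mu E * m = \int[mu]_(x in E) cst m x by rewrite integral_cst// muleC.
apply: ae_ge0_le_integral => //.
- by move=> x Ex; rewrite lee_fin ltW// v0//; exact: EB.
- exact/measurable_EFinP.
by apply: filterS mle => x + /EB; apply.
Qed.

End Muckenhoupt.

(** * Doubling measures and compactness of closed balls *)

Section Doubling.
Context {R : realType} {X : completeMetricType R}.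
Variables (mu : {outer_measure set X -> \bar R}) (Cd : R).
Hypotheses (reg : borel_regular mu) (Cd1 : (1 < Cd)%R) (dbl : doubling mu Cd).
Implicit Types (x y : X) (r s e : R).

Lemma open_metric_ball x r : open (ball x r).
Proof.
rewrite openE => y; rewrite [in X in X -> _]ballEmdist/= => xy; apply/nbhs_ballP.
exists (r - mdist x y)%R; first by rewrite /= subr_gt0.
move=> z; rewrite !ballEmdist/=; have := metric_triangle x y z; lra.
Qed.

Lemma measurable_cara_open (U : set X) : open U -> mu.-cara.-measurable U.
Proof. by move=> oU; apply: reg.1; exact: sub_sigma_algebra. Qed.

Lemma measurable_cara_ball x r : mu.-cara.-measurable (ball x r).
Proof. exact/measurable_cara_open/open_metric_ball. Qed.

Lemma measurable_cara_compact (K : set X) : compact K -> mu.-cara.-measurable K.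
Proof.
move=> /(compact_closed (@metric_hausdorff _ _)) cK.
rewrite -(setCK K); apply: measurableC; apply: measurable_cara_open.
exact: closed_openC.
Qed.

Lemma mu_ball_gt0 x r : (0 < r)%R -> 0 < mu (ball x r).
Proof.
move=> r0; have [|+ _ _] := @dbl x (r / 2)%R; first by rewrite divr_gt0.
by rewrite mulrCA divff ?mulr1.
Qed.

Lemma mu_ball_fin_num x r : (0 < r)%R -> mu (ball x r) \is a fin_num.
Proof.
move=> r0; have [_ _] := dbl x r0; rewrite ge0_fin_numE ?outer_measure_ge0//.
apply: le_lt_trans; rewrite -[leLHS]mul1e lee_wpmul2r ?outer_measure_ge0//.
by rewrite lee_fin ltW.
Qed.

Lemma doubling_iter n x r : (0 < r)%R ->
  mu (ball x (2 ^+ n * r)) <= (Cd ^+ n)%:E * mu (ball x r).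
Proof.
move=> r0; elim: n => [|n IH]; first by rewrite !expr0 mul1r mul1e.
have [|_ + _] := @dbl x (2 ^+ n * r)%R; first by rewrite mulr_gt0// exprn_gt0.
rewrite mulrA -exprS => /le_trans; apply.
by rewrite exprS EFinM -muleA lee_wpmul2l// lee_fin (le_trans ler01)// ltW.
Qed.

Lemma mu_ball_compare n x y r s : (0 < s)%R -> (r + mdist x y <= 2 ^+ n * s)%R ->
  mu (ball x r) <= (Cd ^+ n)%:E * mu (ball y s).
Proof.
move=> s0 rs; apply: le_trans (doubling_iter n y s0).
apply: le_outer_measure => z; rewrite !ballEmdist/= => xz.
by have := metric_triangle y x z; rewrite (metric_sym y x); lra.
Qed.

Definition separated e (l : seq X) :=
  pairwise (fun y z => e <= mdist y z)%R l.

(** Balls of radius [e / 2] around [e]-separated points are disjoint. *)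
Lemma measure_separated_balls e (l : seq X) : separated e l ->
  \sum_(y <- l) mu (ball y (e / 2)) <= mu (\big[setU/set0]_(y <- l) ball y (e / 2)).
Proof.
elim: l => [|y l IH]; first by rewrite !big_nil outer_measure0.
rewrite /separated pairwise_cons => /andP[/allP yl /IH{}IH].
rewrite !big_cons.
have mU : mu.-cara.-measurable (\big[setU/set0]_(z <- l) ball z (e / 2)).
  by apply: bigsetU_measurable => z _; exact: measurable_cara_ball.
rewrite (@measureU _ _ _ (cara_measure mu)) => //.
- exact: leeD2l.
- exact: measurable_cara_ball.
rewrite -subset0 => u [yu]; rewrite -bigcup_seq => -[z /= zl zu].
have := yl _ zl; move: yu zu; rewrite !ballEmdist/= metric_sym => yu zu.
have := metric_triangle y u z; rewrite (metric_sym y u) (metric_sym u z).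
move: yu zu; lra.
Qed.

(** Without a finite net there are [e]-separated lists of every length in the
    ball. By doubling, the balls of radius [e / 2] around their points all have
    measure at least a fixed fraction of that of a slightly larger concentric
    ball, in which they are disjoint; this bounds the length of the list. *)
Lemma finite_net x s e : (0 <= s)%R -> (0 < e)%R ->
  exists l : seq X, [set y | mdist x y <= s]%R `<=`
    \big[setU/set0]_(y <- l) ball y e.
Proof.
move=> s0 e0; apply: contrapT => nonet.
pose in_ball y := (mdist x y <= s)%R.
have sep n : exists l, [/\ size l = n, all in_ball l & separated e l].
  elim: n => [|n [l [sl xl el]]]; first by exists [::].
  have [y [xy yl]] : exists y, (mdist x y <= s)%R /\
      forall z, z \in l -> (e <= mdist y z)%R.
    apply: contrapT => H; apply: nonet; exists l => y /= xy.
    rewrite -bigcup_seq; apply: contrapT => yl; apply: H; exists y.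
    split=> // z zl; rewrite leNgt; apply/negP => yz; apply: yl.
    by exists z => //; rewrite ballEmdist/= metric_sym.
  exists (y :: l); split; rewrite /= ?sl//.
    by rewrite xl andbT.
  by apply/andP; split; [exact/allP|exact: el].
pose r := (s + e)%R; have r0 : (0 < r)%R by rewrite /r; lra.
pose n := (Num.truncn ((r + s) / (e / 2))).+1.
have rn : (r + s <= 2 ^+ n * (e / 2))%R.
  rewrite -ler_pdivrMr ?divr_gt0//; apply/ltW/(lt_le_trans (truncnS_gt _)).
  by rewrite -natrX ler_nat ltnW// ltn_expl.
pose k := (Num.truncn (Cd ^+ n)).+1.
have [l [lk xl el]] := sep k.
have M0 := mu_ball_gt0 x r0; have Mfin := mu_ball_fin_num x r0.
set M := mu (ball x r) in M0 Mfin.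
have : \sum_(y <- l) M <= (Cd ^+ n)%:E * M.
  apply: (@le_trans _ _ (\sum_(y <- l) (Cd ^+ n)%:E * mu (ball y (e / 2)))).
    rewrite !big_seq; apply: lee_sum => y yl.
    apply: mu_ball_compare; first by rewrite divr_gt0.
    by apply: le_trans rn; rewrite lerD2l; have /allP/(_ _ yl) := xl.
  rewrite -ge0_sume_distrr; last by move=> *; exact: outer_measure_ge0.
  apply: lee_wpmul2l; first by rewrite lee_fin exprn_ge0// (le_trans ler01)// ltW.
  apply: (le_trans (measure_separated_balls el)); apply: le_outer_measure.
  rewrite -bigcup_seq => z [y /= yl]; rewrite !ballEmdist/= => yz.
  have /allP/(_ _ yl) := xl; have := metric_triangle x y z.
  by move: yz; rewrite /in_ball /r; lra.
rewrite -(fineK Mfin) sumEFin -EFinM lee_fin big_const_seq count_predT lk.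
rewrite iter_addr_0 -mulr_natl ler_pM2r ?fine_gt0 ?M0 ?ltey_eq ?Mfin//.
by rewrite leNgt truncnS_gt.
Qed.

(** An ultrafilter containing the ball contains, for each [e], a member of a
    finite cover by [e]-balls; so it is Cauchy, and converges by completeness. *)
Lemma compact_closed_ball x s : compact [set y | mdist x y <= s]%R.
Proof.
have [s0|s0] := ltP s 0%R.
  rewrite (_ : [set _ | _] = set0); first exact: compact0.
  by rewrite -subset0 => y /= /le_lt_trans/(_ s0); rewrite ltNge mdist_ge0.
rewrite compact_ultra => F UF FK.
have Fball e : (0 < e)%R -> exists y, F (ball y e).
  move=> e0; have [l /filterS/(_ FK)] := finite_net x s0 e0.
  elim: l => [|y l IH]; first by rewrite big_nil => /filter_not_empty.
  rewrite big_cons => Fyl.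
  have [Fy|Fny] := in_ultra_setVsetC (ball y e) UF; first by exists y.
  apply: IH; apply: filterS (filterI Fyl Fny) => z [[]//].
have /cauchy_cvg/cvg_ex[p Fp] : cauchy F.
  by apply: cauchy_exP => e e0; exact: Fball.
exists p; split => //=; apply/ler_addgt0Pr => e e0.
have Fpe : F (ball p e) by apply: Fp; exact: nbhsx_ballx.
have [z [/= xz]] := filter_ex (filterI FK Fpe).
by rewrite ballEmdist/=; have := metric_triangle x z p; rewrite (metric_sym z p); lra.
Qed.

(** Local integrability says something on compact subsets of [D] only; an open
    ball in [D] is a countable union of concentric closed balls, which are
    compact. *)
Lemma measurable_loc_integrable_ball (D : set X) (w : X -> R) x r :
  loc_integrable mu D w -> ball x r `<=` D ->
  measurable_fun (ball x r : set (caratheodory_type mu)) w.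
Proof.
move=> locw BD.
pose K (n : nat) : set (caratheodory_type mu) :=
  [set y | mdist x y <= r - n.+1%:R^-1]%R.
have cK n : compact (K n : set X) by exact: compact_closed_ball.
have -> : (ball x r : set (caratheodory_type mu)) = \bigcup_n K n.
  apply/seteqP; split => [y|y [n _]]; rewrite ballEmdist/= /K/=; last first.
    by move=> /le_lt_trans; apply; rewrite ltrBlDr ltrDl invr_gt0.
  rewrite -subr_gt0 => xy; exists (Num.truncn (r - mdist x y)^-1)%R => //=.
  rewrite lerBrDr -lerBrDl -[leRHS]invrK lef_pV2 ?posrE ?invr_gt0//.
  exact/ltW/truncnS_gt.
apply/measurable_fun_bigcup => n; first exact: measurable_cara_compact.
have KD : K n `<=` D.
  move=> y /= xy; apply: BD; rewrite ballEmdist/= (le_lt_trans xy)//.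
  by rewrite ltrBlDr ltrDl invr_gt0.
by have /integrableP[/measurable_EFinP] := locw _ (cK n) KD.
Qed.

End Doubling.

(** * Integrals of the weight over nested balls *)

(** Adding 1 to the Muckenhoupt constant makes the factor at least 1, and for
    [p = 1], where that constant is an infimum, it leaves room for an admissible
    bound. The power of [Cd] is the price of [n] doublings. *)
Definition compare_const (R : realType) (Cd p Q : R) (n : nat) : R :=
  ((`|Q| + 1) * (Cd ^+ n) `^ p)%R.

Lemma compare_const_ge1 (R : realType) (Cd p Q : R) (n : nat) :
  (1 < Cd)%R -> (1 <= p)%R -> (1 <= compare_const Cd p Q n)%R.
Proof.
move=> Cd1 p1; rewrite -[leLHS]mulr1 ler_pM//; first by rewrite lerDr.
apply: (@le_trans _ _ (1 `^ p)%R); first by rewrite powR1.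
rewrite ge0_ler_powR ?nnegrE ?(le_trans ler01)//.
  by rewrite exprn_ege1// ltW.
by rewrite exprn_ege1// ltW.
Qed.

Section WeightOnBalls.
Context {R : realType} {X : completeMetricType R}.
Variables (mu : {outer_measure set X -> \bar R}) (Cd : R).
Hypotheses (reg : borel_regular mu) (Cd1 : (1 < Cd)%R) (dbl : doubling mu Cd).
Variables (D : set X) (w : X -> R) (p Q : R).
Hypotheses (p1 : (1 <= p)%R) (hw : muckenhoupt mu D p w).
Hypothesis hQ : muckenhoupt_const mu D p w = Q%:E.

Let cara_ae_filter : Filter (almost_everywhere (cara_measure mu)) :=
  ae_filter_ringOfSetsType (cara_measure mu).

(* A version of the weight that is positive everywhere. *)
Let v (x : X) : R := if (0 < w x)%R then w x else 1%R.

Let v_gt0 x : (0 < v x)%R.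
Proof. by rewrite /v; case: ifP. Qed.

Let vw_ae : {ae cara_measure mu, forall x, D x -> v x = w x}.
Proof.
by apply: (@filterS _ _ cara_ae_filter _ _ _ hw.1.2) => x /[apply]; rewrite /v => ->.
Qed.

Let measurable_w (x : X) (r : R) : ball x r `<=` D ->
  measurable_fun (ball x r : set (caratheodory_type mu)) w.
Proof.
by move=> BD; exact: (measurable_loc_integrable_ball reg Cd1 dbl hw.1.1 BD).
Qed.

Let measurable_v (x : X) (r : R) : ball x r `<=` D ->
  measurable_fun (ball x r : set (caratheodory_type mu)) v.
Proof.
move=> BD; apply: measurable_fun_if.
- exact: measurable_cara_ball.
- by apply: measurable_fun_ltr => //; exact: measurable_w.
- by apply: measurable_funS (measurable_w BD) => //; exact: measurable_cara_ball.
- exact: measurable_cst.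
Qed.

Let integral_vw (f : R -> R) (x : X) (r : R) :
  measurable_fun setT f -> ball x r `<=` D ->
  \int[cara_measure mu]_(y in ball x r) (f (w y))%:E =
  \int[cara_measure mu]_(y in ball x r) (f (v y))%:E.
Proof.
move=> mf BD; apply: ae_eq_integral.
- exact: measurable_cara_ball.
- apply/measurable_EFinP; exact: (measurableT_comp mf (measurable_w BD)).
- apply/measurable_EFinP; exact: (measurableT_comp mf (measurable_v BD)).
by apply: (@filterS _ _ cara_ae_filter _ _ _ vw_ae) => y vwy /BD /vwy ->.
Qed.

Lemma integral_weight_ball_ge0 (x : X) (r : R) : ball x r `<=` D ->
  0 <= \int[cara_measure mu]_(z in ball x r) (w z)%:E.
Proof.
move=> BD; rewrite (integral_vw (@measurable_id _ _ setT) BD).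
by apply: integral_ge0 => z _; rewrite lee_fin ltW.
Qed.

(** Both cases of the Muckenhoupt condition in one form: the fraction of the
    measure of the ball that lies in the subball, to the power [p], bounds the
    corresponding fraction of the weight from below, up to a constant. *)
Lemma muckenhoupt_subset_compare (x y : X) (r s : R) :
  (0 < r)%R -> (0 < s)%R -> ball x r `<=` D -> ball y s `<=` ball x r ->
  \int[cara_measure mu]_(z in ball x r) (w z)%:E * mu (ball y s) `^ p <=
  ((`|Q| + 1)%:E * mu (ball x r) `^ p) *
    \int[cara_measure mu]_(z in ball y s) (w z)%:E.
Proof.
move=> r0 s0 BD EB; have ED := subset_trans EB BD.
rewrite (integral_vw (@measurable_id _ _ setT) BD).
rewrite (integral_vw (@measurable_id _ _ setT) ED).
have mB := measurable_cara_ball reg x r; have mE := measurable_cara_ball reg y s.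
have mv := measurable_v BD; have vB z : ball x r z -> (0 < v z)%R by [].
have B0 := mu_ball_gt0 dbl x r0; have Bfin := mu_ball_fin_num Cd1 dbl x r0.
have Q0 : (0 <= `|Q| + 1)%R by rewrite addr_ge0.
have W0 : 0 <= \int[cara_measure mu]_(z in ball y s) (v z)%:E.
  by apply: integral_ge0 => z _; rewrite lee_fin ltW.
move: hQ hw.2; rewrite /muckenhoupt_const; have [p_eq1 A1|p_neq1 Ap _] := eqVneq p 1%R.
- move=> _; rewrite p_eq1 !poweRe1 ?outer_measure_ge0//.
  have [_ [c [c0 A1c] <-]] : exists2 c : \bar R, [set c%:E | c in A1_bound mu D w] c
      & c < (Q + 1)%:E.
    by apply: ereal_inf_lt; rewrite -/(A1_const mu D w) A1 lte_fin ltrDl.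
  rewrite lte_fin => cQ.
  have := A1c x r r0 BD; rewrite /average -(fineK Bfin) inver.
  rewrite gt_eqF ?fine_gt0 ?B0 ?ltey_eq ?Bfin//.
  rewrite lee_pdivrMl ?fine_gt0 ?B0 ?ltey_eq ?Bfin// fineK// => H.
  apply: (@le_trans _ _ ((c%:E * mu (ball x r)) *
      \int[cara_measure mu]_(z in ball y s) (v z)%:E)); last first.
    rewrite lee_wpmul2r// lee_wpmul2r ?outer_measure_ge0// lee_fin.
    by rewrite (le_trans (ltW cQ))// lerD2r ler_norm.
  apply: (A1_subset_compare (mu := cara_measure mu)
    (m := ess_inf_on mu (ball x r) w)) => //.
  + exact: ltW.
  + apply: (@filterS2 _ _ cara_ae_filter _ _ _ _ vw_ae
      (ess_inf_le (cara_measure mu)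
        (patch (fun=> +oo) (ball x r) (EFin \o w)))) => z vwz wz Bz.
    by rewrite vwz; [apply: (le_trans wz); rewrite /patch mem_set|exact: BD].
  + by rewrite -(integral_vw (@measurable_id _ _ setT) BD) (le_trans H)// muleC.
have p_gt1 : (1 < p)%R by rewrite lt_neqAle eq_sym p_neq1.
have : average mu (ball x r) w *
    (average mu (ball x r) (fun x => w x `^ (- (p - 1)^-1))%R) `^ (p - 1) <= Q%:E.
  by rewrite -Ap; apply: ereal_sup_ubound; exists (x, r).
rewrite /average (integral_vw (@measurable_id _ _ setT) BD).
rewrite (integral_vw (measurable_powR _) BD).
set a := integral _ _ _; set b := integral _ _ _ => H.
have a0 : 0 <= a by apply: integral_ge0 => z _; rewrite lee_fin ltW.
have b0 : 0 <= b by apply: integral_ge0 => z _; rewrite lee_fin powR_ge0.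
apply: (Ap_subset_compare p_gt1) => //.
rewrite -/a -/b.
have m0 : (0 < fine (mu (ball x r)))%R by rewrite fine_gt0// B0 ltey_eq Bfin.
move: H; rewrite -(fineK Bfin) inver gt_eqF//; set m := fine _ in m0 *.
have im0 : (0 <= m^-1)%R by rewrite invr_ge0 ltW.
have -> : cara_measure mu (ball x r) = m%:E by rewrite fineK.
rewrite poweRM// !poweR_EFin.
rewrite muleACA -EFinM.
have -> : (m^-1 * m^-1 `^ (p - 1) = (m `^ p)^-1)%R.
  rewrite -{1}[(m^-1)%R](powRr1)//.
  rewrite -powRD; last by rewrite addrC subrK gt_eqF ?(lt_trans ltr01).
  by rewrite addrC subrK -(powR_inv1 (ltW m0)) -powRrM mulN1r powRN.
rewrite lee_pdivrMl ?powR_gt0// => /le_trans; apply.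
by rewrite -!EFinM lee_fin mulrC ler_wpM2r ?powR_ge0// (le_trans (ler_norm _))// lerDl.
Qed.

(** After [n] doublings the subball covers the ball, so that their measures have
    a ratio at most [Cd ^+ n]. *)
Lemma weight_ball_compare n (x y : X) (r s : R) :
  (0 < r)%R -> (0 < s)%R -> ball x r `<=` D -> ball y s `<=` ball x r ->
  (r + mdist x y <= 2 ^+ n * s)%R ->
  \int[cara_measure mu]_(z in ball y s) (w z)%:E <=
    \int[cara_measure mu]_(z in ball x r) (w z)%:E /\
  \int[cara_measure mu]_(z in ball x r) (w z)%:E <=
  (compare_const Cd p Q n)%:E * \int[cara_measure mu]_(z in ball y s) (w z)%:E.
Proof.
move=> r0 s0 BD EB rs; have ED := subset_trans EB BD; split.
  rewrite (integral_vw (@measurable_id _ _ setT) BD).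
  rewrite (integral_vw (@measurable_id _ _ setT) ED).
  apply: ge0_subset_integral => //; try exact: measurable_cara_ball.
    by apply/measurable_EFinP; exact: measurable_v.
  by move=> z _; rewrite lee_fin ltW.
have W0 : 0 <= \int[cara_measure mu]_(z in ball y s) (w z)%:E.
  rewrite (integral_vw (@measurable_id _ _ setT) ED).
  by apply: integral_ge0 => z _; rewrite lee_fin ltW.
have := muckenhoupt_subset_compare r0 s0 BD EB.
have Bfin := mu_ball_fin_num Cd1 dbl x r0.
have E0 := mu_ball_gt0 dbl y s0; have Efin := mu_ball_fin_num Cd1 dbl y s0.
have := mu_ball_compare Cd1 dbl s0 rs.
rewrite -(fineK Bfin) -(fineK Efin) !poweR_EFin -EFinM lee_fin => BE H.
have Ep : (0 < fine (mu (ball y s)) `^ p)%R.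
  by rewrite powR_gt0// fine_gt0// E0 ltey_eq Efin.
rewrite -(@lee_pmul2r _ (fine (mu (ball y s)) `^ p)%:E)//.
apply: (le_trans H); rewrite [leRHS]muleAC lee_wpmul2r// -!EFinM lee_fin.
rewrite /compare_const -mulrA ler_wpM2l ?addr_ge0//.
rewrite -powRM ?exprn_ge0 ?fine_ge0 ?outer_measure_ge0//; last first.
  exact: le_trans ler01 (ltW _).
by rewrite ge0_ler_powR ?nnegrE ?mulr_ge0 ?exprn_ge0 ?fine_ge0
  ?outer_measure_ge0 ?(le_trans ler01) ?(ltW Cd1).
Qed.

End WeightOnBalls.

(** * Whitney balls *)

(** All the pairs of nested balls below have radii whose ratio, with the distance
    of the centers added to the larger radius, is at most [4 * A * (A + 3)]; this
    many doublings suffice for all of them. *)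
Definition doubling_steps (R : realType) (A : R) : nat :=
  (Num.truncn (4 * A * (A + 3))%R).+1.

Lemma doubling_stepsP (R : realType) (A : R) : (1 <= A)%R ->
  (4 * A * (A + 3) <= 2 ^+ doubling_steps A)%R.
Proof.
move=> A1; apply/ltW/(lt_le_trans (truncnS_gt _)).
by rewrite -natrX ler_nat ltnW// ltn_expl.
Qed.

Lemma doubling_ratio_ge (R : realType) (A : R) : (1 <= A)%R ->
  (16 <= 4 * A * (A + 3))%R /\ (A + 3 <= 4 * A * (A + 3))%R.
Proof. by move=> A1; split; nra. Qed.

Section Whitney.
Context {R : realType} {X : completeMetricType R}.
Variables (mu : {outer_measure set X -> \bar R}) (Cd : R).
Hypotheses (reg : borel_regular mu) (Cd1 : (1 < Cd)%R) (dbl : doubling mu Cd).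
Variables (D : set X) (w : X -> R) (p Q A : R).
Hypotheses (p1 : (1 <= p)%R) (hw : muckenhoupt mu D p w).
Hypothesis hQ : muckenhoupt_const mu D p w = Q%:E.
Hypotheses (A1 : (1 <= A)%R) (geo : geodesic_space X) (oD : open D).
Hypothesis D0 : boundary D !=set0.

Let W (B : set X) : \bar R := \int[cara_measure mu]_(x in B) (w x)%:E.
Let K := compare_const Cd p Q (doubling_steps A).

Definition whitney_ball z : set X := ball z (boundary_dist D z / 4).

Let compare x y (r s : R) : (0 < r)%R -> (0 < s)%R -> ball x r `<=` D ->
  (mdist x y + s <= r)%R -> (r + mdist x y <= 4 * A * (A + 3) * s)%R ->
  W (ball y s) <= W (ball x r) /\ W (ball x r) <= K%:E * W (ball y s).
Proof.
move=> r0 s0 BD yx rs; apply: (weight_ball_compare reg Cd1 dbl p1 hw hQ) => //.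
  move=> z; rewrite !ballEmdist/=; have := metric_triangle x y z; lra.
by apply: (le_trans rs); rewrite ler_pM2r// doubling_stepsP.
Qed.

(** Both Whitney balls lie in the ball of [D] around [z] whose radius is the
    distance of [z] to the boundary, and the radii are comparable because that
    distance is 1-Lipschitz. *)
Lemma whitney_ball_step z z' : D z -> D z' ->
  (mdist z z' <= boundary_dist D z / 4)%R ->
  W (whitney_ball z) <= K%:E * W (whitney_ball z') /\
  W (whitney_ball z') <= K%:E * W (whitney_ball z).
Proof.
move=> Dz Dz' zz'; rewrite /whitney_ball.
have BD := ball_boundary_dist_sub geo oD D0 Dz.
have d0 := boundary_dist_gt0 D0 oD Dz.
have d'0 := boundary_dist_gt0 D0 oD Dz'.
have dd' := boundary_dist_lipschitz z z' D0.
have d'd := boundary_dist_lipschitz z' z D0; rewrite metric_sym in d'd.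
have [M16 _] := doubling_ratio_ge A1.
have Md := ler_wpM2r (ltW d0) M16; have Md' := ler_wpM2r (ltW d'0) M16.
have [||//|||H1 H2] := @compare z z (boundary_dist D z) (boundary_dist D z / 4)%R.
- by [].
- by rewrite divr_gt0.
- by rewrite mdistxx; lra.
- by rewrite mdistxx; lra.
have [||//|||G1 G2] := @compare z z' (boundary_dist D z) (boundary_dist D z' / 4)%R.
- by [].
- by rewrite divr_gt0.
- by lra.
- by lra.
by split; [exact: le_trans G2|exact: le_trans H2].
Qed.

(** With [a := A^-1 * r], the small ball of radius [a / 4] around [y] lies both in
    the Whitney ball at [y] and in the largest ball of [D] around [x]. The latter
    contains the given ball, and its radius is at least [r + a], which leaves room
    around [y] even if [y] is near the edge of the given ball. *)
Lemma whitney_ball_compare x y (r : R) : (0 < r)%R -> ball x r `<=` D ->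
  (A^-1 * r)%:E <= set_dist (ball x r) (boundary D) <= (A * r)%:E ->
  ball x r y ->
  W (ball x r) <= K%:E * W (whitney_ball y) /\
  W (whitney_ball y) <= (K ^+ 2)%:E * W (ball x r).
Proof.
move=> r0 BD /andP[lb ub] xy; have A0 : (0 < A)%R by rewrite (lt_le_trans ltr01).
have K0 : (0 <= K)%R by rewrite (le_trans ler01)// compare_const_ge1.
have xx : ball x r x by rewrite ballEmdist/= mdistxx.
have rd := boundary_dist_center_ge geo D0 oD r0 BD lb.
have dr := boundary_dist_le_in_ball D0 ub xx.
have yd := boundary_dist_ge_in_ball D0 lb xy.
have dy := boundary_dist_le_in_ball D0 ub xy.
have {}xy : (mdist x y < r)%R by move: xy; rewrite ballEmdist.
set a := (A^-1 * r)%R in lb rd yd.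
have a0 : (0 < a)%R by rewrite mulr_gt0 ?invr_gt0.
have rE : r = (A * a)%R by rewrite /a mulrA divff ?mul1r// gt_eqF.
have Ma : (4 * A * (A + 3) * (a / 4) = (A + 3) * r)%R by rewrite rE; field.
have [_ MA] := doubling_ratio_ge A1; have Mr := ler_wpM2r (ltW r0) MA.
have ar : (a <= r)%R by rewrite rE ler_peMl// ltW.
have Dx := BD _ xx.
have Dy : D y by apply: BD; rewrite ballEmdist.
have xD := ball_boundary_dist_sub geo oD D0 Dx.
have yD := ball_boundary_dist_sub geo oD D0 Dy.
set dx := boundary_dist D x in rd dr xD.
rewrite /whitney_ball; set dy' := boundary_dist D y in yd dy yD *.
have m0 := mdist_ge0 x y.
(* the small ball around y, in the largest ball around x *)
have [||//|||H1 H2] := @compare x y dx (a / 4)%R.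
- by lra.
- by rewrite divr_gt0.
- by lra.
- by rewrite Ma; lra.
(* the given ball, in the largest ball around x *)
have [||||| G1 G2] := @compare x x dx r.
- by lra.
- by [].
- by [].
- by rewrite mdistxx; lra.
- by rewrite mdistxx; lra.
(* the small ball around y, in the Whitney ball at y *)
have [||||| I1 I2] := @compare y y (dy' / 4)%R (a / 4)%R.
- by lra.
- by rewrite divr_gt0.
- apply: subset_trans yD => z; rewrite !ballEmdist/=; lra.
- by rewrite mdistxx; lra.
- by rewrite mdistxx Ma; lra.
split.
  apply: (le_trans G1); apply: (le_trans H2).
  by rewrite lee_wpmul2l ?lee_fin.
apply: (le_trans I2); rewrite expr2 (EFinM K K) -muleA.
apply: lee_wpmul2l; rewrite ?lee_fin//.
exact: le_trans G2.
Qed.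

End Whitney.

Theorem lemma4p4 (R : realType) (Cd C A p Q : R) :
  (1 < Cd)%R -> (1 <= A)%R -> (1 <= p)%R ->
  exists K : R, (1 <= K)%R /\
  forall (X : completeMetricType R) (mu : {outer_measure set X -> \bar R})
    (D : set X) (w : X -> R) (x1 x2 : X) (r1 r2 : R),
  borel_regular mu -> mu [set: X] != 0 -> doubling mu Cd ->
  geodesic_space X -> domain D ->
  muckenhoupt mu D p w -> muckenhoupt_const mu D p w = Q%:E ->
  (0 < r1)%R -> (0 < r2)%R ->
  let B1 := ball x1 r1 in
  let B2 := ball x2 r2 in
  B1 `<=` D -> B2 `<=` D ->
  (A^-1 * r1)%:E <= set_dist B1 (boundary D) <= (A * r1)%:E ->
  (A^-1 * r2)%:E <= set_dist B2 (boundary D) <= (A * r2)%:E ->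
  quasihyperbolic_set D B1 B2 <= C%:E ->
  let W := fun B : set X => \int[cara_measure mu]_(x in B) (w x)%:E in
  K^-1%:E * W B2 <= W B1 /\ W B1 <= K%:E * W B2.
Proof.
move=> Cd1 A1 p1; pose K := compare_const Cd p Q (doubling_steps A).
have K1 : (1 <= K)%R by apply: compare_const_ge1.
have K0 : (0 < K)%R by rewrite (lt_le_trans ltr01).
(* The chain has at most n steps as n / 5 exceeds C + 1. At either end of it
   the given ball is compared with the Whitney ball at a point of its own, at
   the cost of a factor K in one direction and K ^+ 2 in the other. *)
pose n := (Num.truncn (5 * (`|C| + 1))%R).+1.
exists (K ^+ (n + 3))%R; split; first by rewrite exprn_ege1.
move=> X mu D w x1 x2 r1 r2 reg _ dbl geo [_ _ oD _] hw hQ r10 r20 B1 B2.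
move=> B1D B2D B1b B2b qh W.
have D0 : boundary D !=set0 by case/andP: B1b => _; exact: boundary_neq0.
have : quasihyperbolic_set D B1 B2 < (C + 1)%:E.
  by apply: (le_lt_trans qh); rewrite lte_fin ltrDl.
move=> /ereal_inf_lt[_ [x B1x' [y B2y' <-]]] /ereal_inf_lt[_ [g [a [b [gr ->]]]]].
rewrite /line_integral; have := arclength_paramP gr.
set L := fine _; set h := arclength_param g a b => -[L0 h0 hL hD hlip] len.
have F0 z : D z -> 0 <= W (whitney_ball D z).
  move=> Dz; apply: (integral_weight_ball_ge0 reg Cd1 dbl hw).
  apply: subset_trans (ball_boundary_dist_sub geo oD D0 Dz) => u.
  by have := boundary_dist_gt0 D0 oD Dz; rewrite !ballEmdist/=; lra.
have step := whitney_ball_step reg Cd1 dbl p1 hw hQ A1 geo oD D0.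
have [||H1 H2] := harnack_chain D0 oD hD hlip K1 F0 step (n := n) (v := 0%R).
- by rewrite lexx.
- apply: (lt_trans len); rewrite lte_fin ltr_pdivlMr//.
  rewrite (le_lt_trans _ (truncnS_gt _))// mulrC ler_pM2l// lerD2r.
  exact: ler_norm.
have ends := whitney_ball_compare reg Cd1 dbl p1 hw hQ A1 geo oD D0.
have [B1x xB1] := ends _ _ _ r10 B1D B1b B1x'.
have [B2y yB2] := ends _ _ _ r20 B2D B2b B2y'.
rewrite h0 hL in H1 H2.
have chain u1 u2 v1 v2 : u1 <= K%:E * v1 -> v1 <= (K ^+ n)%:E * v2 ->
    v2 <= (K ^+ 2)%:E * u2 -> u1 <= (K ^+ (n + 3))%:E * u2.
  have Kn m : 0 <= (K ^+ m)%:E by rewrite lee_fin exprn_ge0// ltW.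
  move=> uv /(lee_wpmul2l (Kn 1%N)) vv /(lee_wpmul2l (Kn n.+1)) vu.
  apply: (le_trans uv); apply: (le_trans vv).
  move: vu; rewrite !muleA -!EFinM expr1 -exprS -exprD addSnnS.
  exact.
split; last exact: chain B1x H1 yB2.
by rewrite lee_pdivrMl ?exprn_gt0//; exact: chain B2y H2 xB1.
Qed.
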